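(* Let $\chi_1,\chi_2$ be primitive quadratic Dirichlet characters of respective conductors $q_1,q_2$ with $\chi_1\chi_2(-1)=1$, and suppose $q_1,q_2>4$ are both odd. Then \[ S_{\chi_1,\chi_2}(\Gamma_0(q_1q_2)) \subseteq \frac{1}{\gcd(q_1,q_2)}\,\mathbb{Z}. \]
   Context: $B_1(x)=0$ if $x\in\mathbb{Z}$ and $B_1(x)=x-\lfloor x\rfloor-\tfrac12$ otherwise. $\Gamma_0(N)$ is the group of matrices $\begin{pmatrix}a&b\\c&d\end{pmatrix}\in SL_2(\mathbb{Z})$ with $N\mid c$. For $\gamma=\begin{pmatrix}a&b\\c&d\end{pmatrix}\in\Gamma_0(q_1q_2)$ with $c\ge 1$, the newform Dedekind sum is \[S_{\chi_1,\chi_2}(\gamma)=S_{\chi_1,\chi_2}(a,c)=\sum_{j \bmod c}\ \sum_{n \bmod q_1}\overline{\chi_2}(j)\overline{\chi_1}(n)B_1\Big(\frac{j}{c}\Big)B_1\Big(\frac{n}{q_1}+\frac{aj}{c}\Big);\] it is extended to all of $\Gamma_0(q_1q_2)$ by $S_{\chi_1,\chi_2}(\gamma)=0$ if $c=0$ and $S_{\chi_1,\chi_2}(\gamma)=S_{\chi_1,\chi_2}(-\gamma)$ if $c<0$ (this is the map arising from newform Eisenstein series, which satisfies $S(\gamma_1\gamma_2)=S(\gamma_1)+\chi_1\overline{\chi_2}(d_1)S(\gamma_2)$ where $d_1$ is the lower-right entry of $\gamma_1$). *)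

(* Defs.v *)
From HB Require Import structures.
From mathcomp Require Import all_boot all_order all_algebra.

Set Implicit Arguments.
Unset Strict Implicit.
Unset Printing Implicit Defensive.

Import Order.TTheory GRing.Theory Num.Theory.
Local Open Scope ring_scope.

(* [C] plays the role of the complex numbers; both [algC] and [R[i]] are
   instances of [numClosedFieldType]. A Dirichlet character mod [q] is viewed
   as a function on the integers, extended by 0 off the residues prime to [q];
   [chi 1 = 1] follows from the three axioms. *)
Record dirichlet_char (C : numClosedFieldType) (q : nat) := DirichletChar {
  dchar :> int -> C;
  dchar_mod : forall m n : int, (m = n %[mod q])%Z -> dchar m = dchar n;
  dcharM : forall m n : int, dchar (m * n) = dchar m * dchar n;
  dchar_eq0 : forall n : int, (dchar n == 0) = ~~ coprimez n q
}.

Definition induced_from (C : numClosedFieldType) (q d : nat)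
    (chi : dirichlet_char C q) : Prop :=
  exists psi : dirichlet_char C d,
    forall n : int, coprimez n q -> chi n = psi n.

(* For [0 < q], this says that the conductor of [chi] is [q]. *)
Definition primitive_char (C : numClosedFieldType) (q : nat)
    (chi : dirichlet_char C q) : Prop :=
  forall d : nat, (d %| q)%N -> induced_from d chi -> d = q.

(* Order exactly 2 in the group of characters mod [q]. *)
Definition quadratic_char (C : numClosedFieldType) (q : nat)
    (chi : dirichlet_char C q) : Prop :=
  (forall n : int, coprimez n q -> chi n ^+ 2 = 1) /\
  (exists2 n : int, coprimez n q & chi n != 1).

Definition B1 (x : rat) : rat :=
  if x \is a Num.int then 0 else x - (Num.floor x)%:~R - 1 / 2%:R.

Definition Gamma0 (N : nat) : {pred 'M[int]_2} :=
  [pred g : 'M[int]_2 | (\det g == 1) && (N %| g ord_max ord0)%Z].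

(* The finite double sum S(a, c), meant for [0 < c]. *)
Definition dedekind_sum (C : numClosedFieldType) (q1 q2 : nat)
    (chi1 : dirichlet_char C q1) (chi2 : dirichlet_char C q2)
    (a : int) (c : nat) : C :=
  \sum_(j < c) \sum_(n < q1)
    (chi2 j)^* * (chi1 n)^* *
    ratr (B1 (j%:R / c%:R)) * ratr (B1 (n%:R / q1%:R + a%:~R * j%:R / c%:R)).

Definition newform_dedekind_sum (C : numClosedFieldType) (q1 q2 : nat)
    (chi1 : dirichlet_char C q1) (chi2 : dirichlet_char C q2)
    (g : 'M[int]_2) : C :=
  let S (h : 'M[int]_2) :=
    dedekind_sum chi1 chi2 (h ord0 ord0) `|h ord_max ord0|%N in
  let c := g ord_max ord0 in
  if c == 0 then 0 else if 0 < c then S g else S (- g).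

(* Main.v *)
(** The sum is in fact an integer. Since [chi1] sums to 0 over a period, the
    inner sum [F x = \sum_n chi1 n * B1 (n / q1 + x)] is, off [(1/q1) Z], a step
    function constant on the intervals [(t / q1, (t + 1) / q1)], with value the
    generalized Bernoulli number of [chi1] minus an integer; that number is an
    integer because [q1] is odd, [chi1] is primitive and [q1 <> 3]. Put [m = c / q1], a multiple of
    [q2]. Splitting [r = t m + s] and using that [chi2] sums to 0 over [s < m]
    and that the values of [F] sum to 0 over [t < q1], both
    [\sum_r chi2 r * F (r / c)] and [\sum_r r * chi2 r * F (r / c)] vanish.
    Substituting [r = a j], [\sum_j chi2 j * F (a j / c)] is 0 and
    [\sum_j j * chi2 j * F (a j / c)] is 0 mod [c]; as [B1 (j / c)] is
    [j / c - 1 / 2], the double sum is an integer. *)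

Require Import Defs.
From mathcomp Require Import all_boot all_order all_algebra.
From mathcomp Require Import ring zify.
Import Order.TTheory GRing.Theory Num.Theory.
Local Open Scope ring_scope.

(** * Sums over residues, floors, and [B1] at fractions *)

Lemma sum_ord_mul {V : nmodType} (k m : nat) (F : nat -> V) :
  \sum_(r < k * m) F r = \sum_(t < k) \sum_(s < m) F (t * m + s)%N.
Proof.
rewrite -(big_mkord xpredT F) big_nat_mul big_mkord; apply: eq_bigr => t _.
rewrite -{1}[(t * m)%N]add0n big_addn mulSn addnK big_mkord.
by apply: eq_bigr => s _; rewrite addnC.
Qed.

(** Multiplication by a unit permutes the residues mod [c]. *)
Lemma sum_periodicM {V : nmodType} (c : nat) (a : int) (f : int -> V) :
  (forall m n : int, (m = n %[mod c])%Z -> f m = f n) -> coprimez a c ->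
  \sum_(j < c) f (a * (j : nat)%:Z) = \sum_(j < c) f (j : nat)%:Z.
Proof.
case: c => [|c] f_mod co_ac; first by rewrite !big_ord0.
pose h (j : 'I_c.+1) : 'I_c.+1 := inord `|((a * (j : nat)%:Z) %% c.+1)%Z|%N.
have hE (j : 'I_c.+1) : (h j : nat)%:Z = ((a * (j : nat)%:Z) %% c.+1)%Z.
  rewrite /h inordK; first by rewrite gez0_abs ?modz_ge0.
  by rewrite -ltz_nat gez0_abs ?modz_ge0 // ltz_pmod.
have h_inj : injective h.
  move=> i j eq_h; apply: ord_inj.
  move/eqP: (congr1 (fun k : 'I__ => (k : nat)%:Z) eq_h).
  rewrite /= !hE eqz_mod_dvd -mulrBr Gauss_dvdzr; last by rewrite coprimez_sym.
  by rewrite -eqz_mod_dvd !modz_small ?lez_nat ?ltz_nat ?ltn_ord // => /eqP[].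
rewrite [RHS](reindex_inj h_inj); apply: eq_bigr => j _.
by apply: f_mod; rewrite hE modz_mod.
Qed.

(** Hermite's identity. Passing from [n] to [n + 1] trades the term [n %/ q] for [(n + q) %/ q],
    which is larger by 1. *)
Lemma sum_div_shift (q n : nat) :
  (0 < q)%N -> (\sum_(t < q) (n + t) %/ q = n)%N.
Proof.
move=> q_gt0; elim: n => [|n IHn].
  by rewrite big1 // => t _; rewrite add0n divn_small.
have := big_ord_recr q (fun t => ((n + t) %/ q)%N) (op := addn) (idx := 0%N).
rewrite big_ord_recl IHn addn0 divnDr ?dvdnn // divnn q_gt0.
under eq_bigr => t _ do rewrite /= addnS -addSn.
rewrite /= addn1 => H; apply: (@addnI (n %/ q)%N); rewrite H; lia.
Qed.

Lemma sum_modz_eq (c : nat) (I : Type) (r : seq I) (F G : I -> int) :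
  (forall i, F i = G i %[mod c])%Z ->
  (\sum_(i <- r) F i = \sum_(i <- r) G i %[mod c])%Z.
Proof.
move=> eqFG; apply/eqP; rewrite eqz_mod_dvd -sumrB.
by apply: rpred_sum => i _; rewrite -eqz_mod_dvd; apply/eqP/eqFG.
Qed.

Lemma rat_floor_div (u : int) (c : nat) : (0 < c)%N ->
  Num.floor (u%:~R / c%:R : rat) = (u %/ c)%Z.
Proof.
move=> c_gt0; apply: floor_def.
have c_gt0' : 0 < c%:R :> rat by rewrite ltr0n.
rewrite ler_pdivlMr // ltr_pdivrMr // -[c%:R]/(c%:~R) -!intrM ler_int ltr_int.
by rewrite lez_floor ?ltz_ceil // -?lt0n //; lia.
Qed.

Lemma B1_ratio (u : int) (c : nat) : (0 < c)%N -> ~~ (c %| u)%Z ->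
  B1 (u%:~R / c%:R) = u%:~R / c%:R - (u %/ c)%Z%:~R - 1 / 2%:R.
Proof.
move=> c_gt0 ndvd; rewrite /B1 rat_floor_div // ifN //.
apply: contra ndvd => /intrP[z uz]; apply/dvdzP; exists z.
have /(congr1 ( *%R^~ c%:R)) := uz.
rewrite divfK ?pnatr_eq0 -?lt0n // -[c%:R]/(c%:~R) -intrM => /intr_inj.
by move=> uz0; rewrite uz0.
Qed.

(** * Quadratic characters with integer values *)

Record real_char (q : nat) (s : int -> int) : Prop := RealChar {
  real_char_mod : forall m n : int, (m = n %[mod q])%Z -> s m = s n;
  real_charM : forall m n : int, s (m * n) = s m * s n;
  real_char_eq0 : forall n : int, (s n == 0) = ~~ coprimez n q;
  real_char_sqr : forall n : int, coprimez n q -> s n ^+ 2 = 1;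
  real_char_neq1 : exists2 n : int, coprimez n q & s n != 1 }.

Arguments real_char_mod {q s} _ [m n].
Arguments real_charM {q s}.
Arguments real_char_eq0 {q s}.
Arguments real_char_sqr {q s} _ [n].
Arguments real_char_neq1 {q s}.

Lemma quadratic_real_char {C : numClosedFieldType} {q : nat}
    {chi : dirichlet_char C q} : quadratic_char chi ->
  exists2 s, real_char q s & forall n, chi n = (s n)%:~R.
Proof.
move=> [chi_sqr [n0 co_n0 chi_n0]].
pose s n : int := if chi n == 0 then 0 else if chi n == 1 then 1 else -1.
have sE n : chi n = (s n)%:~R.
  rewrite /s; case: eqVneq => [-> //|chi_n].
  have := chi_sqr n; rewrite -[coprimez _ _]negbK -(dchar_eq0 chi).
  by move=> /(_ chi_n)/eqP; rewrite sqrf_eq1; case: eqVneq => [->|_ /= /eqP->].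
exists s => //; split=> [m n eq_mn|m n|n|n co_n|].
- by rewrite /s (dchar_mod _ eq_mn).
- by apply: (@intr_inj C); rewrite intrM -!sE dcharM.
- by rewrite -(dchar_eq0 chi) sE intr_eq0.
- by apply: (@intr_inj C); rewrite rmorphXn /= -sE chi_sqr.
by exists n0 => //; apply: contra chi_n0; rewrite sE => /eqP->.
Qed.

Section RealChar.
Context {q : nat} {s : int -> int} (chi : real_char q s).

(** Orthogonality: with [s n0 != 1], the substitution [j -> n0 j] multiplies the sum over one period
    by [s n0] yet preserves it. *)
Lemma real_char_sum (m : nat) : (q %| m)%N -> \sum_(j < m) s (j : nat)%:Z = 0.
Proof.
case/dvdnP=> k ->; rewrite (sum_ord_mul k q (fun j => s j%:Z)).
rewrite big1 // => t _.
under eq_bigr => j _ do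
  rewrite PoszD PoszM (real_char_mod chi (modzMDl _ _ _)).
have [n0 co_n0 n0_neq1] := real_char_neq1 chi.
have := sum_periodicM q n0 s (real_char_mod chi) co_n0.
rewrite (eq_bigr _ (fun (j : 'I_q) _ => real_charM chi n0 (j : nat)%:Z)).
rewrite -mulr_sumr.
 set S := \sum_(j < q) _ => /eqP.
rewrite -subr_eq0 -{2}[S]mul1r -mulrBl mulf_eq0 subr_eq0 (negPf n0_neq1).
by move=> /eqP.
Qed.

(* The substitution [n -> r n] gives [(1 - s r * r) * sum = 0 mod q]; with
   [r = 2] only a factor 3 of [q] can survive in the denominator of [sum / q],
   and then [s] agrees with the character mod 3. *)
Lemma real_char_moment_dvd : odd q ->
    ~ ((3 %| q)%N /\ forall r, coprimez r q -> (s r * r = 1 %[mod 3])%Z) ->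
  (q %| \sum_(n < q) s (n : nat)%:Z * (n : nat)%:Z)%Z.
Proof.
move=> q_odd not3; set T := \sum_(n < q) _.
have dvdT r : coprimez r q -> (q %| (s r * r - 1) * T)%Z.
  move=> co_r; rewrite mulrBl mul1r -eqz_mod_dvd.
  have f_mod (m n : int) : (m = n %[mod q])%Z ->
      s m * (m %% q)%Z = s n * (n %% q)%Z.
    by move=> eq_mn; rewrite (real_char_mod chi eq_mn) eq_mn.
  (* Reducing the factor [n] mod [q] makes the summand periodic. *)
  have -> : T = \sum_(n < q) s (n : nat)%:Z * ((n : nat)%:Z %% q)%Z.
    by apply: eq_bigr => n _; rewrite modz_small // lez_nat ltz_nat ltn_ord.
  rewrite -{2}(sum_periodicM q r _ f_mod co_r) mulr_sumr.
  apply/eqP; apply: sum_modz_eq => n; rewrite (real_charM chi) modzMmr.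
  have -> : ((n : nat)%:Z %% q)%Z = n.
    by rewrite modz_small // lez_nat ltz_nat ltn_ord.
  by congr (modz _ _); ring.
(* [d] is the denominator of [T / q] in lowest terms; the goal amounts to [d = 1]. *)
pose g := gcdz q T; pose d : int := (q %/ g)%Z.
have q_gt0 : (0 < q)%N by case: (q) q_odd.
have g_neq0 : g != 0.
  by rewrite gcdz_eq0 negb_and -[q%:Z == 0]/(q == 0)%N -lt0n q_gt0.
have qE : q = d * g :> int by rewrite /d divzK ?dvdz_gcdl.
have dvdd r : coprimez r q -> (d %| s r * r - 1)%Z.
  move=> co_r; set x := s r * r - 1.
  have : (q %| gcdz (x * q) (x * T))%Z by rewrite dvdz_gcd dvdz_mull ?dvdT.
  rewrite -mulz_gcdr -/g => q_dvd; rewrite -(dvdz_mul2r g_neq0) -qE.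
  by move: q_dvd; rewrite !dvdzE !abszM absz_nat.
have d_dvd : (d %| q%:Z)%Z by rewrite qE dvdz_mulr.
have [d1|d_neq1] := eqVneq d 1.
  by rewrite qE d1 mul1r dvdz_gcdr.
(* Since [s 2] is 1 or -1, [d] divides [s 2 * 2 - 1], which is 1 or -3. *)
have d3 : d = 3.
  have co2 : coprimez 2 q by rewrite coprimezE coprime2n.
  have d_ge0 : 0 <= d by rewrite divz_ge0 // lt_neqAle eq_sym g_neq0.
  have := dvdd 2 co2; have /eqP := real_char_sqr chi co2.
  rewrite sqrf_eq1 => /orP[]/eqP->; rewrite dvdzE.
    by rewrite dvdn1 => /eqP d_1; move: d_ge0 d_neq1; lia.
  move: d_ge0 d_neq1; case: (d) => // -[|[|[|[|n]]]] // _ _.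
case: not3; split=> [|r co_r]; first by rewrite d3 in d_dvd.
by apply/eqP; rewrite eqz_mod_dvd -d3 dvdd.
Qed.

End RealChar.

(* Such an [s] is induced from the nontrivial character mod 3. *)
Lemma primitive_not_mod3 {C : numClosedFieldType} {q : nat}
    {chi : dirichlet_char C q} {s : int -> int} :
    primitive_char chi -> real_char q s -> (forall n, chi n = (s n)%:~R) ->
    (3 < q)%N ->
  ~ ((3 %| q)%N /\ forall r, coprimez r q -> (s r * r = 1 %[mod 3])%Z).
Proof.
move=> prim s_char sE q_gt3 [dvd3q s_mod3].
pose t (n : int) : int := if (n == 0 %[mod 3])%Z then 0
  else if (n == 1 %[mod 3])%Z then 1 else -1.
have t_mod m n : (m = n %[mod 3])%Z -> t m = t n by rewrite /t => ->.
have res3 n : exists2 r : int, (n = r %[mod 3])%Z & r \in [:: 0; 1; -1].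
  have : (n %% 3)%Z \in [:: 0; 1; 2] by rewrite !inE; lia.
  rewrite !inE => /or3P[]/eqP n3; [exists 0 | exists 1 | exists (-1)] => //.
have tM m n : t (m * n) = t m * t n.
  have [[m' mE m_in] [n' nE n_in]] := (res3 m, res3 n).
  rewrite (t_mod (m * n) (m' * n')); last by rewrite -modzMm mE nE modzMm.
  rewrite (t_mod _ _ mE) (t_mod _ _ nE); move: m_in n_in {mE nE}.
  by rewrite !inE => /or3P[]/eqP-> /or3P[]/eqP->.
have t_eq0 n : (t n == 0) = ~~ coprimez n 3.
  have [n' nE n_in] := res3 n; rewrite (t_mod _ _ nE).
  rewrite /coprimez -gcdz_modl nE gcdz_modl; move: n_in {nE}.
  by rewrite !inE => /or3P[]/eqP->.
have p1 m n : (m = n %[mod 3%N])%Z -> (t m)%:~R = (t n)%:~R :> C.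
  by move=> /t_mod->.
have p2 m n : (t (m * n))%:~R = (t m)%:~R * (t n)%:~R :> C by rewrite tM intrM.
have p3 n : ((t n)%:~R == 0 :> C) = ~~ coprimez n 3%N by rewrite intr_eq0 t_eq0.
have : 3%N = q; last by move=> q3; rewrite -q3 in q_gt3.
apply: prim dvd3q _; exists (DirichletChar p1 p2 p3) => n co_n.
(* As [s n] is 1 or -1, the congruence forces [s n] to be the residue of [n] mod 3, that is
   [t n]. *)
rewrite sE /=; congr (_%:~R); have := s_mod3 n co_n.
have [n' nE n_in] := res3 n; rewrite (t_mod _ _ nE) -modzMmr nE modzMmr.
have /eqP := real_char_sqr s_char co_n; rewrite sqrf_eq1; move: n_in {nE}.
by rewrite !inE => /or3P[]/eqP-> /orP[]/eqP->.
Qed.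

(** * The step function, its moments, and integrality over the rationals *)

Section IntegralSum.
Context {q1 q2 m : nat} {s1 s2 : int -> int}.
Context (chi1 : real_char q1 s1) (chi2 : real_char q2 s2).
Context (q1_gt0 : (0 < q1)%N) (q2_gt1 : (1 < q2)%N).
Context (m_gt0 : (0 < m)%N) (q2_dvd_m : (q2 %| m)%N).
Context (b : int).
Hypothesis b_def : \sum_(n < q1) s1 (n : nat)%:Z * (n : nat)%:Z = b * q1.
Local Notation c := (q1 * m)%N.

(* [step k] is the value at [k / c] of [x |-> \sum_n s1 n * B1 (n / q1 + x)];
   [b] is the generalized Bernoulli number of [s1]. *)
Definition step (k : int) : int :=
  b - \sum_(n < q1) s1 (n : nat)%:Z * (((n * m)%N%:Z + k) %/ c)%Z.

Lemma step_mod (k l : int) : (k = l %[mod c])%Z -> step k = step l.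
Proof.
move=> eq_kl; rewrite (divz_eq k c) (divz_eq l c) eq_kl.
(* Each floor grows by [z], and [z] times the full sum of [s1] is 0. *)
have shift (z r : int) : step (z * c + r) = step r.
  rewrite /step; congr (_ - _).
  have c_neq0 : c%:Z != 0 by rewrite -[_ == 0]/(c == 0)%N -lt0n muln_gt0 q1_gt0.
  under [LHS]eq_bigr => n _ do rewrite addrCA divzMDl // mulrDr.
  by rewrite big_split /= -mulr_suml (real_char_sum chi1) // mul0r add0r.
by rewrite !shift.
Qed.

Definition block (t : nat) : int :=
  b - \sum_(n < q1) s1 (n : nat)%:Z * ((n + t) %/ q1)%N%:Z.

(** Dividing by [m] before [q1] discards the remainder [s]. *)
Lemma step_block (t s : nat) : (s < m)%N -> step (t * m + s)%N = block t.
Proof.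
move=> s_lt; congr (_ - _); apply: eq_bigr => n _; congr (_ * _).
rewrite -PoszD addnA -mulnDl divz_nat [(q1 * m)%N]mulnC divnMA divnMDl //.
by rewrite (divn_small s_lt) addn0.
Qed.

(** Summing over [t] first, Hermite's identity turns the floors into the first moment [b * q1] of
    [s1], which cancels the [q1] copies of [b]. *)
Lemma sum_block : \sum_(t < q1) block t = 0.
Proof.
rewrite sumrB sumr_const card_ord exchange_big /=.
under eq_bigr => n _.
  rewrite -mulr_sumr -(big_morph Posz PoszD (erefl 0%:Z)) sum_div_shift //.
  over.
by rewrite b_def -mulr_natr natz subrr.
Qed.

Lemma sum_step (w : nat -> int) :
  \sum_(r < c) w r * step (r : nat)%:Z =
  \sum_(t < q1) (\sum_(s < m) w (t * m + s)%N) * block t.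
Proof.
rewrite (sum_ord_mul q1 m (fun r => w r * step r%:Z)); apply: eq_bigr => t _.
by rewrite mulr_suml; apply: eq_bigr => s _; rewrite step_block.
Qed.

Let s2_shift (t s : nat) : s2 (t * m + s)%N = s2 s.
Proof.
apply: (real_char_mod chi2); apply/eqP.
by rewrite eqz_mod_dvd PoszD addrK dvdzE /= dvdn_mull.
Qed.

Lemma sum_char_block (t : nat) : \sum_(s < m) s2 (t * m + s)%N = 0.
Proof.
rewrite -[RHS](real_char_sum chi2 m q2_dvd_m); apply: eq_bigr => s _.
exact: s2_shift.
Qed.

Lemma sum_char_step : \sum_(r < c) s2 (r : nat)%:Z * step (r : nat)%:Z = 0.
Proof.
rewrite (sum_step (fun r => s2 r%:Z)) big1 // => t _.
by rewrite sum_char_block mul0r.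
Qed.

Lemma sum_moment_step :
  \sum_(r < c) (r : nat)%:Z * s2 (r : nat)%:Z * step (r : nat)%:Z = 0.
Proof.
rewrite (sum_step (fun r => r%:Z * s2 r%:Z)).
have inner (t : nat) : \sum_(s < m) (t * m + s)%N%:Z * s2 (t * m + s)%N =
    \sum_(s < m) (s : nat)%:Z * s2 (s : nat)%:Z.
  under eq_bigr => s _ do rewrite PoszD mulrDl.
  rewrite big_split /= -mulr_sumr sum_char_block mulr0 add0r.
  by apply: eq_bigr => s _; rewrite -PoszD s2_shift.
under eq_bigr => t _ do rewrite inner.
by rewrite -mulr_sumr sum_block mulr0.
Qed.

Context {a : int} (co_ac : coprimez a c).

Let co_aq2 : coprimez a q2.
Proof.
by move: co_ac; rewrite !coprimezE; apply: coprime_dvdr; rewrite /= dvdn_mull.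
Qed.

Let c_gt0 : (0 < c)%N. Proof. by rewrite muln_gt0 q1_gt0. Qed.

Let s2_mod (k l : int) : (k = l %[mod c])%Z -> s2 k = s2 l.
Proof.
move=> /eqP eq_kl; apply: (real_char_mod chi2); apply/eqP; move: eq_kl.
rewrite !eqz_mod_dvd; apply: dvdz_trans.
by rewrite dvdzE /= dvdn_mull.
Qed.

Lemma sum_char_stepM :
  \sum_(j < c) s2 (j : nat)%:Z * step (a * (j : nat)%:Z) = 0.
Proof.
(* The nonzero factor [s2 a] turns [s2 j] into [s2 (a * j)], so that [r = a j] can be
   substituted. *)
have s2a_neq0 : s2 a != 0 by rewrite (real_char_eq0 chi2) negbK.
apply: (mulfI s2a_neq0); rewrite mulr0 -[RHS]sum_char_step mulr_sumr.
rewrite -(sum_periodicM c a (fun k => s2 k * step k) _ co_ac).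
  by apply: eq_bigr => j _; rewrite (real_charM chi2) mulrA.
by move=> k l eq_kl; rewrite (s2_mod _ _ eq_kl) (step_mod _ _ eq_kl).
Qed.

(* Multiplying by the unit [s2 a * a] and substituting [r = a j] reduces the
   sum mod [c] to the case [a = 1], where it vanishes. *)
Lemma dvd_sum_moment_stepM :
  (c %| \sum_(j < c) (j : nat)%:Z * s2 (j : nat)%:Z *
          step (a * (j : nat)%:Z))%Z.
Proof.
set S := \sum_(j < c) _.
suff : (c %| a * (s2 a * S))%Z.
  rewrite Gauss_dvdzr; last by rewrite coprimez_sym.
  move=> /(dvdz_mull (s2 a)); rewrite mulrA -expr2.
  by rewrite (real_char_sqr chi2 co_aq2) mul1r.
have per (k l : int) : (k = l %[mod c])%Z ->
    (k %% c)%Z * s2 k * step k = (l %% c)%Z * s2 l * step l.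
  by move=> eq_kl; rewrite (s2_mod _ _ eq_kl) (step_mod _ _ eq_kl) eq_kl.
(* Subtracting a vanishing sum turns the divisibility into a congruence of sums; writing [r] as
   [r %% c] then makes the summand periodic. *)
rewrite -[_ * _]subr0 -[X in _ - X]sum_moment_step.
under [X in _ - X]eq_bigr => r _.
  rewrite -{1}(@modz_small (r : nat)%:Z c); last first.
    by rewrite lez_nat ltz_nat ltn_ord.
  over.
rewrite -(sum_periodicM c a _ per co_ac) -eqz_mod_dvd !mulr_sumr.
apply/eqP; apply: sum_modz_eq => j; rewrite /= (real_charM chi2).
rewrite -[(_ %% _)%Z * _ * _]mulrA modzMml.
by congr (modz _ _); ring.
Qed.

Lemma sum_B1_step (j : int) : s2 j != 0 ->
  \sum_(n < q1) (s1 (n : nat)%:Z)%:~R * B1 (n%:R / q1%:R + a%:~R * j%:~R / c%:R)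
    = (step (a * j))%:~R.
Proof.
move=> s2j_neq0.
have q1_neq0 : q1%:R != 0 :> rat by rewrite pnatr_eq0 -lt0n.
have m_neq0 : m%:R != 0 :> rat by rewrite pnatr_eq0 -lt0n.
(* No argument of [B1] is an integer: otherwise [q2] would divide [a * j], hence [j], against
   [s2 j != 0]. *)
have ndvd (n : nat) : ~~ (c %| (n * m)%N%:Z + a * j)%Z.
  apply/negP => c_dvd.
  have : (q2 %| (n * m)%N%:Z + a * j)%Z.
    by apply: dvdz_trans c_dvd; rewrite dvdzE /= dvdn_mull.
  rewrite rpredDl; last by rewrite dvdzE /= dvdn_mull.
  rewrite Gauss_dvdzr; last by rewrite coprimez_sym.
  move=> q2_dvd_j; case/negP: s2j_neq0; rewrite (real_char_eq0 chi2).
  rewrite /coprimez; move/gcdz_idPr: q2_dvd_j => ->.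
  by rewrite /=; lia.
(* [K] collects what does not depend on [n]; the zero sum of [s1] removes it. *)
pose K : rat := (a * j)%:~R / c%:R - 1 / 2%:R.
have termE (n : nat) :
    (s1 n)%:~R * B1 (n%:R / q1%:R + a%:~R * j%:~R / c%:R) =
      (s1 n * n)%:~R / q1%:R
        - (s1 n * (((n * m)%N%:Z + a * j) %/ c)%Z)%:~R + (s1 n)%:~R * K.
  have uE : n%:R / q1%:R + a%:~R * j%:~R / c%:R
      = ((n * m)%N%:Z + a * j)%:~R / c%:R :> rat.
    rewrite intrD intrM -[(n * m)%N%:~R]/((n * m)%N%:R) !natrM.
    by field; rewrite q1_neq0 m_neq0.
  by rewrite uE B1_ratio // -uE /K !intrM -[(Posz n)%:~R]/(n%:R : rat); ring.
rewrite (eq_bigr _ (fun (n : 'I_q1) _ => termE n)) big_split sumrB /=.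
rewrite -!mulr_suml -!rmorph_sum /= (real_char_sum chi1) // b_def.
by rewrite mul0r addr0 /step rmorphB intrM /= mulfK.
Qed.

Lemma sum_B1_int : exists z : int,
  \sum_(j < c) (s2 (j : nat)%:Z)%:~R * B1 (j%:R / c%:R) *
    (\sum_(n < q1) (s1 (n : nat)%:Z)%:~R *
       B1 (n%:R / q1%:R + a%:~R * j%:R / c%:R)) = z%:~R.
Proof.
have /dvdzP[z zE] := dvd_sum_moment_stepM.
have c_neq0 : c%:R != 0 :> rat by rewrite pnatr_eq0 -lt0n.
exists z; transitivity (\sum_(j < c)
    (((j : nat)%:Z * s2 (j : nat)%:Z * step (a * (j : nat)%:Z))%:~R / c%:R
     - (s2 (j : nat)%:Z * step (a * (j : nat)%:Z))%:~R / 2%:R) : rat); last first.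
  rewrite sumrB -!mulr_suml -!rmorph_sum /= sum_char_stepM zE mul0r subr0.
  by rewrite intrM mulfK.
apply: eq_bigr => j _; have [s2j0|s2j_neq0] := eqVneq (s2 j) 0.
  by rewrite s2j0 mulr0 !mul0r subrr.
rewrite (sum_B1_step j s2j_neq0) -[j%:R]/((j : nat)%:Z%:~R).
(* The value [B1 0 = 0] breaks the linear formula, but [s2 0 = 0] because [q2 > 1]. *)
have j_gt0 : (0 < j)%N.
  case: posnP s2j_neq0 => // j0; rewrite j0 (real_char_eq0 chi2) negbK.
  by rewrite /coprimez gcd0z; lia.
rewrite B1_ratio //; last by rewrite dvdzE /= gtnNdvd.
by rewrite divz_nat divn_small // !intrM; ring.
Qed.

End IntegralSum.

(** * Transfer to the complex sum and to matrices *)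

Lemma dedekind_sum_int {C : numClosedFieldType} {q1 q2 : nat}
    {chi1 : dirichlet_char C q1} {chi2 : dirichlet_char C q2}
    {a : int} {c : nat} :
    primitive_char chi1 -> quadratic_char chi1 -> quadratic_char chi2 ->
    (3 < q1)%N -> odd q1 -> (1 < q2)%N ->
    (0 < c)%N -> (q1 * q2 %| c)%N -> coprimez a c ->
  exists z : int, dedekind_sum chi1 chi2 a c = z%:~R.
Proof.
move=> prim1 quad1 quad2 q1_gt3 q1_odd q2_gt1.
have [s1 char1 s1E] := quadratic_real_char quad1.
have [s2 char2 s2E] := quadratic_real_char quad2.
have not3 := primitive_not_mod3 prim1 char1 s1E q1_gt3.
have /dvdzP[b b_def] := real_char_moment_dvd char1 q1_odd not3.
move=> c_gt0 /dvdnP[k cE]; have {cE} cE : c = (q1 * (k * q2))%N.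
  by rewrite cE; ring.
rewrite cE muln_gt0 in c_gt0 *; have /andP[q1_gt0 m_gt0] := c_gt0.
move=> co_ac; have [z zE] :=
  sum_B1_int char1 char2 q1_gt0 q2_gt1 m_gt0
    (dvdn_mull k (dvdnn q2)) b b_def co_ac.
pose f : {rmorphism rat -> C} := @ratr C.
exists z; rewrite -(ratr_int C) -zE -[RHS]/(f _) rmorph_sum.
apply: eq_bigr => j _; rewrite [RHS]rmorphM rmorph_sum mulr_sumr.
apply: eq_bigr => n _; rewrite ![in RHS](rmorphM f) /= !ratr_int s1E s2E.
(* Conjugation fixes the integer character values. *)
by rewrite !rmorph_int; ring.
Qed.

(** Expanding the determinant along the first column gives a Bezout relation. *)
Lemma det2_coprimez (g : 'M[int]_2) :
  \det g = 1 -> coprimez (g ord0 ord0) (g ord_max ord0).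
Proof.
rewrite (expand_det_col g ord0) big_ord_recl big_ord1 => det1.
have max1 : lift ord0 ord0 = ord_max :> 'I_2 by apply: ord_inj.
apply/coprimezP; exists (cofactor g ord0 ord0, cofactor g ord_max ord0).
by rewrite /= -det1 max1 addrC [X in _ + X]mulrC [X in X + _]mulrC addrC.
Qed.

Theorem theorem1p7 (C : numClosedFieldType) (q1 q2 : nat)
    (chi1 : dirichlet_char C q1) (chi2 : dirichlet_char C q2)
    (prim1 : primitive_char chi1) (prim2 : primitive_char chi2)
    (quad1 : quadratic_char chi1) (quad2 : quadratic_char chi2)
    (parity : chi1 (-1) * chi2 (-1) = 1)
    (q1_gt4 : (4 < q1)%N) (q2_gt4 : (4 < q2)%N)
    (q1_odd : odd q1) (q2_odd : odd q2)
    (g : 'M[int]_2) (gG : g \in Gamma0 (q1 * q2)) :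
  exists m : int,
    newform_dedekind_sum chi1 chi2 g = m%:~R / (gcdn q1 q2)%:R.
Proof.
have gcd_neq0 : (gcdn q1 q2)%:R != 0 :> C.
  by rewrite pnatr_eq0 -lt0n gcdn_gt0 (ltn_trans _ q1_gt4).
suff [z zE] : exists z : int, newform_dedekind_sum chi1 chi2 g = z%:~R.
  by exists (z * gcdn q1 q2); rewrite zE intrM mulfK.
have /andP[/eqP det1 dvd_c] := gG; have co := det2_coprimez g det1.
rewrite /newform_dedekind_sum; case: eqVneq => [_|c_neq0]; first by exists 0.
have c_gt0 : (0 < `|g ord_max ord0|)%N by rewrite absz_gt0.
have int_sum (a : int) : coprimez a (g ord_max ord0) ->
    exists z : int, dedekind_sum chi1 chi2 a `|g ord_max ord0|%N = z%:~R.
  move=> co_a; apply: dedekind_sum_int => //.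
  - exact: ltn_trans q1_gt4.
  - exact: ltn_trans q2_gt4.
case: ifP => _; first exact: int_sum.
(* For negative [c], the matrix [- g] has the same [|c|], and [- a] is still prime to [c]. *)
by rewrite !mxE abszN; apply: int_sum; rewrite coprimeNz.
Qed.
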